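(* Let $A=H+Si\in M_2(\mathbb{C})$, where $H\in M_2(\mathbb{C})$ is Hermitian and $S\in M_2(\mathbb{R})$ is diagonal. The upper bild of $A$ is: (i) $B^+(A)=\operatorname{conv}\{W_{\mathbb{C}}^+(A),W_{\mathbb{C}}^+(A^* )\}$, if $S$ is indefinite; (ii) $B^+(A)=\operatorname{conv}\{W_{\mathbb{C}}^+(A),v\}$, for some real value $v$, if $S$ is positive definite; (iii) $B^+(A)=W_{\mathbb{C}}^+(A)$, if $S$ is positive semi-definite.
   Context: $\mathbb{H}$ denotes the Hamilton quaternions with real basis $1,i,j,k$, and $\mathbb{C}=\mathrm{span}_{\mathbb{R}}\{1,i\}\subset\mathbb{H}$. $M_n(\mathbb{F})$ is the set of $n\times n$ matrices with entries in $\mathbb{F}$. For $\mathbb{F}=\mathbb{C}$ or $\mathbb{H}$ and $A\in M_n(\mathbb{F})$, the numerical range is $W_{\mathbb{F}}(A)=\{\boldsymbol{x}^*A\boldsymbol{x}:\boldsymbol{x}\in\mathbb{F}^n,\ \boldsymbol{x}^*\boldsymbol{x}=1\}$, where $\boldsymbol{x}$ is a column vector and $^*$ denotes conjugate transpose. A complex matrix is regarded as a quaternionic matrix. $\mathbb{C}^+$ is the closed upper half plane $\{z\in\mathbb{C}:\mathrm{Im}\,z\ge0\}$. The upper bild is $B^+(A)=W_{\mathbb{H}}(A)\cap\mathbb{C}^+$, and $W_{\mathbb{C}}^+(A)=W_{\mathbb{C}}(A)\cap\mathbb{C}^+$. $\operatorname{conv}\{X,Y\}$ denotes the convex hull of the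 union of the listed sets and points. A real diagonal matrix $S$ is positive definite (resp. positive semi-definite) if $\boldsymbol{x}^*S\boldsymbol{x}>0$ (resp. $\ge 0$) for all real unit vectors $\boldsymbol{x}$, and indefinite if there are real unit vectors $\boldsymbol{x},\boldsymbol{y}$ with $\boldsymbol{x}^*S\boldsymbol{x}>0$ and $\boldsymbol{y}^*S\boldsymbol{y}<0$.
   Formalization: Part (iii) is stated for S positive semi-definite but not positive definite; for positive definite S the equality in (iii) is false (e.g. A = iI, where 0 lies in the upper bild but W_C^+(A) = {i}). *)

(* Defs.v *)
From HB Require Import structures.
From mathcomp Require Import all_boot all_order all_algebra ring.
From mathcomp Require Import complex.
From mathcomp Require Import boolp classical_sets reals convex.

Set Implicit Arguments.
Unset Strict Implicit.
Unset Printing Implicit Defensive.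

Import Order.TTheory GRing.Theory Num.Theory.

Local Open Scope classical_set_scope.
Local Open Scope ring_scope.
Local Open Scope complex_scope.
Local Open Scope sesquilinear_scope.

(* Quat a b c d is a + b i + c j + d k. *)
Record quat (R : Type) : Type := Quat { qRe : R; qI : R; qJ : R; qK : R }.

Section QuatChoice.
Variable R : Type.

Definition tuple_of_quat (x : quat R) : R * R * R * R :=
  (qRe x, qI x, qJ x, qK x).
Definition quat_of_tuple (t : R * R * R * R) : quat R :=
  let: (a, b, c, d) := t in Quat a b c d.

Lemma tuple_of_quatK : cancel tuple_of_quat quat_of_tuple.
Proof. by case. Qed.

End QuatChoice.

HB.instance Definition _ (R : eqType) :=
  Equality.copy (quat R) (can_type (@tuple_of_quatK R)).
HB.instance Definition _ (R : choiceType) :=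
  Choice.copy (quat R) (can_type (@tuple_of_quatK R)).

Section QuatRing.
Variable R : comNzRingType.
Implicit Types x y : quat R.

Definition addq x y :=
  Quat (qRe x + qRe y) (qI x + qI y) (qJ x + qJ y) (qK x + qK y).
Definition oppq x := Quat (- qRe x) (- qI x) (- qJ x) (- qK x).

Definition mulq x y :=
  let: Quat a b c d := x in
  let: Quat a' b' c' d' := y in
  Quat (a * a' - b * b' - c * c' - d * d')
       (a * b' + b * a' + c * d' - d * c')
       (a * c' - b * d' + c * a' + d * b')
       (a * d' + b * c' - c * b' + d * a').

Definition qconj x := Quat (qRe x) (- qI x) (- qJ x) (- qK x).

Lemma addqA : associative addq.
Proof. by move=> x y z; rewrite /addq /= !addrA. Qed.
Lemma addqC : commutative addq.
Proof. by move=> x y; congr Quat; rewrite addrC. Qed.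
Lemma add0q : left_id (Quat 0 0 0 0) addq.
Proof. by case=> a b c d; rewrite /addq /= !add0r. Qed.
Lemma addNq : left_inverse (Quat 0 0 0 0) oppq addq.
Proof. by move=> x; rewrite /addq /= !addNr. Qed.

HB.instance Definition _ :=
  GRing.isZmodule.Build (quat R) addqA addqC add0q addNq.

Lemma mulqA : associative mulq.
Proof. by move=> [????] [????] [????]; congr Quat; ring. Qed.
Lemma mul1q : left_id (Quat 1 0 0 0) mulq.
Proof. by move=> [????]; congr Quat; ring. Qed.
Lemma mulq1 : right_id (Quat 1 0 0 0) mulq.
Proof. by move=> [????]; congr Quat; ring. Qed.
Lemma mulqDl : left_distributive mulq addq.
Proof. by move=> [????] [????] [????]; congr Quat => /=; ring. Qed.
Lemma mulqDr : right_distributive mulq addq.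
Proof. by move=> [????] [????] [????]; congr Quat => /=; ring. Qed.
Lemma oneq_neq0 : Quat 1 0 0 0 != 0 :> quat R.
Proof. by apply/eqP => -[] /eqP; rewrite oner_eq0. Qed.

HB.instance Definition _ := GRing.Zmodule_isNzRing.Build (quat R)
  mulqA mul1q mulq1 mulqDl mulqDr oneq_neq0.

Definition quat_of_complex (z : R[i]) : quat R :=
  Quat (complex.Re z) (complex.Im z) 0 0.

End QuatRing.

(* For F = C or H, with cj the conjugation of F. *)
Definition numrange (F : nzRingType) (cj : F -> F) (n : nat) (A : 'M[F]_n)
    : set F :=
  [set (x ^t cj *m A *m x) 0 0 | x in [set x : 'cV[F]_n | x ^t cj *m x = 1%:M]].

Section NumericalRanges.
Variables (R : realType) (n : nat).
Implicit Types (A : 'M[R[i]]_n) (S : 'M[R]_n).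

Definition upper_half_plane : set R[i] := [set z | 0 <= complex.Im z].

Definition WC A : set R[i] := numrange Num.conj A.

Definition WCplus A : set R[i] := WC A `&` upper_half_plane.

Definition WH (B : 'M[quat R]_n) : set (quat R) := numrange (@qconj R) B.

(* C is the span of 1 and i in H, so the intersection of WH with the upper
   half plane is taken as a preimage along the embedding of C in H. *)
Definition upper_bild A : set R[i] :=
  (@quat_of_complex R @^-1` WH (map_mx (@quat_of_complex R) A))
  `&` upper_half_plane.

Definition real_unit : set 'cV[R]_n := [set x | x^T *m x = 1%:M].

Definition real_qform S (x : 'cV[R]_n) : R := (x^T *m S *m x) 0 0.

Definition posdef S : Prop := forall x, real_unit x -> 0 < real_qform S x.

Definition possemidef S : Prop := forall x, real_unit x -> 0 <= real_qform S x.

Definition indefinite S : Prop :=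
  exists x y, [/\ real_unit x, real_unit y,
                  0 < real_qform S x & real_qform S y < 0].

End NumericalRanges.

(* Convexity with real coefficients: Rcomplex R is R[i] as an R-module. *)
Definition conv_hull (R : realType) (X : set R[i]) : set R[i] :=
  smallest (@convex_set R (Rcomplex R)) X.

(* Main.v *)
(** Write a quaternionic vector as x = y + w j with y, w complex vectors.  Then
    x^* A x is complex iff w^* S y = 0, and in that case it equals
    y^* H y + w^* H w + i (y^* S y - w^* S w).
    Put M = y y^* + w w^*, which can be any positive semi-definite matrix of
    trace 1.  The eigenvalues of S M are y^* S y and w^* S w, so the upper bild
    is the set of tr(H M) + i h with h >= 0 and
    h^2 = tr(S M)^2 - 4 det S det M = (s1 m - s2 (1 - m))^2 + 4 s1 s2 |mu|^2,
    where M = [[m, mu], [mu^*, 1 - m]] and S = diag(s1, s2).  Moving mu along a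
    line on which tr(H M) is constant reaches a matrix of rank one, so the
    complex numerical range is the set of tr(H M) + i tr(S M).
    If s1 s2 = 0 the two descriptions agree.
    If s1 s2 <> 0, then h is a concave (s1 s2 < 0) or convex (s1 s2 > 0) function
    of M by Cauchy-Schwarz, and along the same lines h varies continuously up to
    |tr(S M)| at rank one; hence the upper bild is convex.
    If s1 s2 < 0, then y^* S y >= 0 >= w^* S w, so the value is a convex
    combination of points of the numerical ranges of A and of its adjoint.
    If S > 0, then h vanishes only at M0 = diag(s2, s1) / (s1 + s2) and is
    homogeneous along the rays from M0, so the upper bild is the union of the
    segments from v = tr(H M0) to points of the numerical range. *)

Require Import Defs.
From HB Require Import structures.
From mathcomp Require Import all_boot all_order all_algebra ring lra.
From mathcomp Require Import complex.
From mathcomp Require Import boolp classical_sets reals convex.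
From mathcomp Require Import interval_inference.

Set Implicit Arguments.
Unset Strict Implicit.
Unset Printing Implicit Defensive.

Import Order.TTheory GRing.Theory Num.Theory.

Local Open Scope classical_set_scope.
Local Open Scope ring_scope.
Local Open Scope complex_scope.
Local Open Scope sesquilinear_scope.

(** * Forms of 2 by 2 matrices and complex components *)

Lemma form2E (F : nzRingType) (cj : F -> F) (A : 'M[F]_2) (x : 'cV[F]_2) :
  (x ^t cj *m A *m x) 0 0 =
    (cj (x ord0 0) * A ord0 ord0 + cj (x ord_max 0) * A ord_max ord0) * x ord0 0
  + (cj (x ord0 0) * A ord0 ord_max + cj (x ord_max 0) * A ord_max ord_max)
    * x ord_max 0.
Proof.
have -> : ord_max = lift ord0 ord0 :> 'I_2 by apply/val_inj.
by rewrite !mxE !big_ord_recl !big_ord0 !addr0 !mxE !big_ord_recl !big_ord0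
  !addr0 !mxE.
Qed.

Lemma norm2E (F : nzRingType) (cj : F -> F) (x : 'cV[F]_2) :
  x ^t cj *m x = 1%:M <->
  cj (x ord0 0) * x ord0 0 + cj (x ord_max 0) * x ord_max 0 = 1.
Proof.
have -> : ord_max = lift ord0 ord0 :> 'I_2 by apply/val_inj.
split=> [/matrixP/(_ 0 0)|e].
  by rewrite !mxE !big_ord_recl !big_ord0 !addr0 !mxE.
apply/matrixP => i j; rewrite !ord1.
by rewrite !mxE !big_ord_recl !big_ord0 !addr0 !mxE.
Qed.

Section Components.
Variable R : realType.

Lemma conjCE (z : R[i]) : Num.conj z = conjc z.
Proof. by []. Qed.

Lemma ReD (x y : R[i]) : complex.Re (x + y) = complex.Re x + complex.Re y.
Proof. by case: x y => ? ? []. Qed.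
Lemma ImD (x y : R[i]) : complex.Im (x + y) = complex.Im x + complex.Im y.
Proof. by case: x y => ? ? []. Qed.
Lemma ReM (x y : R[i]) :
  complex.Re (x * y) = complex.Re x * complex.Re y - complex.Im x * complex.Im y.
Proof. by case: x y => ? ? []. Qed.
Lemma ImM (x y : R[i]) :
  complex.Im (x * y) = complex.Re x * complex.Im y + complex.Im x * complex.Re y.
Proof. by case: x y => ? ? []. Qed.

Lemma quatM (x y : quat R) : x * y = Defs.mulq x y.
Proof. by []. Qed.

End Components.

(** * The two sets in real coordinates *)

Section Coordinates.
Variables (R : realType) (a b1 b2 d s1 s2 : R).

Definition hermDiag : 'M[R[i]]_2 :=
  \matrix_(i, j)
    if i == ord0 then if j == ord0 then a +i* s1 else b1 +i* b2
    else if j == ord0 then b1 -i* b2 else d +i* s2.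

Lemma WC_coordsP (z : R[i]) :
  WC hermDiag z <->
  exists y1 y1' y2 y2' : R,
    [/\ y1 ^+ 2 + y1' ^+ 2 + (y2 ^+ 2 + y2' ^+ 2) = 1,
     complex.Re z = a * (y1 ^+ 2 + y1' ^+ 2) + d * (y2 ^+ 2 + y2' ^+ 2)
       + 2 * (b1 * (y1 * y2 + y1' * y2') + b2 * (y1' * y2 - y1 * y2'))
     & complex.Im z = s1 * (y1 ^+ 2 + y1' ^+ 2) + s2 * (y2 ^+ 2 + y2' ^+ 2)].
Proof.
split.
  case=> x /norm2E; rewrite !conjCE.
  move=> /(congr1 (@complex.Re R)) + <-.
  rewrite form2E !conjCE !mxE /=.
  case: (x ord0 0) => p p'; case: (x ord_max 0) => q q'.
  rewrite !(ReD, ReM, ImD, ImM) /= => e.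
  by exists p, p', q, q'; split; [rewrite -[RHS]e|..]; ring.
case=> p [p' [q [q' [e eR eI]]]].
exists (\col_i if i == ord0 then p +i* p' else q +i* q').
  apply/norm2E; rewrite !conjCE !mxE /=; apply/eqP; rewrite eq_complex.
  rewrite ?(ReD, ReM, ImD, ImM) /= -e; apply/andP; split; apply/eqP; ring.
apply/eqP; rewrite eq_complex form2E !conjCE !mxE /= ?(ReD, ReM, ImD, ImM) /=.
rewrite eR eI.
by apply/andP; split; apply/eqP; ring.
Qed.

(** A coordinate [Quat p p' w1 w1'] is (p + p' i) + (w1 + w1' i) j. The last two equations are the
    real and imaginary parts of w^* S y = 0; up to a factor 2 they are the k and j components of x^*
    A x, to which H contributes nothing. *)
Lemma upper_bild_coordsP (z : R[i]) :
  upper_bild hermDiag z <->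
  0 <= complex.Im z /\ exists y1 y1' y2 y2' w1 w1' w2 w2' : R,
    [/\ y1 ^+ 2 + y1' ^+ 2 + (y2 ^+ 2 + y2' ^+ 2)
        + (w1 ^+ 2 + w1' ^+ 2 + (w2 ^+ 2 + w2' ^+ 2)) = 1,
     complex.Re z = a * (y1 ^+ 2 + y1' ^+ 2) + d * (y2 ^+ 2 + y2' ^+ 2)
       + 2 * (b1 * (y1 * y2 + y1' * y2') + b2 * (y1' * y2 - y1 * y2'))
       + (a * (w1 ^+ 2 + w1' ^+ 2) + d * (w2 ^+ 2 + w2' ^+ 2)
       + 2 * (b1 * (w1 * w2 + w1' * w2') + b2 * (w1' * w2 - w1 * w2'))),
     complex.Im z = s1 * (y1 ^+ 2 + y1' ^+ 2) + s2 * (y2 ^+ 2 + y2' ^+ 2)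
       - (s1 * (w1 ^+ 2 + w1' ^+ 2) + s2 * (w2 ^+ 2 + w2' ^+ 2)),
     s1 * (y1 * w1 + y1' * w1') + s2 * (y2 * w2 + y2' * w2') = 0
     & s1 * (y1' * w1 - y1 * w1') + s2 * (y2' * w2 - y2 * w2') = 0].
Proof.
have half (t : R) : 2 * t = 0 -> t = 0 by lra.
split.
  case=> -[x /norm2E ex ez] zge0; split; first exact: zge0.
  move: ez; rewrite form2E !mxE /=; move: ex.
  case: (x ord0 0) => p p' w1 w1'; case: (x ord_max 0) => q q' w2 w2'.
  rewrite !quatM /= => -[e _ _ _] [eR eI eJ eK].
  exists p, p', q, q', w1, w1', w2, w2'; split.
  - by rewrite -[RHS]e; ring.
  - by rewrite -eR; ring.
  - by rewrite -eI; ring.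
  - by apply: half; rewrite -[RHS]eK; ring.
  - by apply: half; rewrite -[RHS]eJ; ring.
case=> zge0 [p [p' [q [q' [w1 [w1' [w2 [w2' [e eR eI eK eJ]]]]]]]]].
split=> //.
exists (\col_(i < 2) if i == ord0 then Quat p p' w1 w1' else Quat q q' w2 w2').
  by apply/norm2E; rewrite !mxE /= !quatM /= ; congr Quat; rewrite /= -?e; ring.
rewrite form2E !mxE /= !quatM /=; congr Quat; rewrite /= ?eR ?eI; try ring.
  by rewrite -[RHS](mulr0 2) -[in RHS]eJ; ring.
by rewrite -[RHS](mulr0 2) -[in RHS]eK; ring.
Qed.

End Coordinates.

(** * Plane geometry and factorisations of positive semi-definite 2 by 2 matrices *)

Section RealAlgebra.
Variable R : realType.
Implicit Types (r i m h k : R).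

Lemma polar r i :
  exists p e f, [/\ e ^+ 2 + f ^+ 2 = 1, 0 <= p, r = p * e & i = p * f].
Proof.
have n0 : 0 <= r ^+ 2 + i ^+ 2 by rewrite addr_ge0 ?sqr_ge0.
have [p0|p0] := eqVneq (Num.sqrt (r ^+ 2 + i ^+ 2)) 0.
  have : r ^+ 2 + i ^+ 2 = 0 by rewrite -(sqr_sqrtr n0) p0 expr0n.
  move/eqP; rewrite paddr_eq0 ?sqr_ge0 // !sqrf_eq0 => /andP[/eqP -> /eqP ->].
  by exists 0, 1, 0; split=> //; ring.
exists (Num.sqrt (r ^+ 2 + i ^+ 2)), (r / Num.sqrt (r ^+ 2 + i ^+ 2)),
  (i / Num.sqrt (r ^+ 2 + i ^+ 2)); split.
- by rewrite !expr_div_n -mulrDl sqr_sqrtr // divff // -(sqr_sqrtr n0) sqrf_eq0.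
- exact: sqrtr_ge0.
- by field.
- by field.
Qed.

(** On the line through (r, i) orthogonal to (c1, c2) the norm is unbounded, so it takes every value
    above the initial one. *)
Lemma adjust_norm (c1 c2 : R) r i k : r ^+ 2 + i ^+ 2 <= k ->
  exists r' i', r' ^+ 2 + i' ^+ 2 = k /\ c1 * r' + c2 * i' = c1 * r + c2 * i.
Proof.
move=> rik; have [p [e [f [ef _ -> ->]]]] := polar c1 c2.
set q := r * f - i * e.
have q0 : 0 <= q ^+ 2 + (k - (r ^+ 2 + i ^+ 2)).
  by rewrite addr_ge0 ?sqr_ge0 // subr_ge0.
(* Root of t^2 + 2 q t = k - (r^2 + i^2), for motion in the unit direction (f, -e). *)
set t := - q + Num.sqrt (q ^+ 2 + (k - (r ^+ 2 + i ^+ 2))).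
exists (r + t * f), (i - t * e); split; last by ring.
have et : (t + q) ^+ 2 = q ^+ 2 + (k - (r ^+ 2 + i ^+ 2)).
  by rewrite -[RHS]sqr_sqrtr // /t; congr (_ ^+ 2); ring.
have -> : (r + t * f) ^+ 2 + (i - t * e) ^+ 2
  = r ^+ 2 + i ^+ 2 + ((t + q) ^+ 2 - q ^+ 2) + t ^+ 2 * (e ^+ 2 + f ^+ 2 - 1).
  by rewrite /q; ring.
by rewrite et ef; ring.
Qed.

Lemma half_angle (e f : R) : e ^+ 2 + f ^+ 2 = 1 ->
  exists c s, [/\ c ^+ 2 + s ^+ 2 = 1, c ^+ 2 - s ^+ 2 = e & 2 * c * s = - f].
Proof.
move=> ef.
have e1 : 0 <= (1 + e) / 2 by nra.
have [c0|c0] := eqVneq (Num.sqrt ((1 + e) / 2)) 0.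
  have e0 : (1 + e) / 2 = 0 by rewrite -(sqr_sqrtr e1) c0 expr0n.
  have e2 : e = -1 by lra.
  have /eqP : f ^+ 2 = 0 by move: ef; rewrite e2; lra.
  rewrite sqrf_eq0 => /eqP ->.
  by exists 0, 1; rewrite e2; split; ring.
set c := Num.sqrt _ in c0 *.
have c2 : c ^+ 2 = (1 + e) / 2 by rewrite sqr_sqrtr.
have c0' : 1 + e != 0.
  by apply: contra c0 => /eqP e0; rewrite /c e0 mul0r sqrtr0.
have s2 : (- f / (2 * c)) ^+ 2 = (1 - e) / 2.
  rewrite expr_div_n exprMn c2.
  have -> : (- f) ^+ 2 = (1 - e) * (1 + e) by rewrite sqrrN; lra.
  by field.
exists c, (- f / (2 * c)); split.
- by rewrite c2 s2; lra.
- by rewrite c2 s2; lra.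
- by field.
Qed.

(** Here det M = 0, so M = y y^*; the common phase is fixed by taking y2 real, and y1 carries the
    phase of r + i 'i. *)
Lemma rank_one_factor m r i : r ^+ 2 + i ^+ 2 = m * (1 - m) ->
  exists y1 y1' y2 y2',
  [/\ y1 ^+ 2 + y1' ^+ 2 = m, y2 ^+ 2 + y2' ^+ 2 = 1 - m,
     y1 * y2 + y1' * y2' = r & y1' * y2 - y1 * y2' = i].
Proof.
move=> rim; have [p [e [f [ef p0 er ei]]]] := polar r i.
have p2 : p ^+ 2 = m * (1 - m).
  by rewrite -rim er ei -[LHS]mulr1 -ef; ring.
have m0 : 0 <= m by nra.
have m1 : 0 <= 1 - m by nra.
have sm := sqr_sqrtr m0; have sn := sqr_sqrtr m1.
have pE : p = Num.sqrt m * Num.sqrt (1 - m).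
  by rewrite -sqrtrM // -p2 sqrtr_sqr ger0_norm.
exists (Num.sqrt m * e), (Num.sqrt m * f), (Num.sqrt (1 - m)), 0; split.
- by rewrite -[RHS]mulr1 -ef -[in RHS]sm; ring.
- by rewrite sn; ring.
- by rewrite er pE; ring.
- by rewrite ei pE; ring.
Qed.

(** Cauchy-Schwarz for the vectors (l, sqrt k r, sqrt k i), proved by Lagrange's identity. *)
Lemma cauchy_schwarz3 (k h1 h2 l1 l2 r1 i1 r2 i2 : R) : 0 <= k ->
  0 <= h1 * h2 ->
  h1 ^+ 2 = l1 ^+ 2 + k * (r1 ^+ 2 + i1 ^+ 2) ->
  h2 ^+ 2 = l2 ^+ 2 + k * (r2 ^+ 2 + i2 ^+ 2) ->
  l1 * l2 + k * (r1 * r2 + i1 * i2) <= h1 * h2.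
Proof.
move=> k0 h0 e1 e2; set u := _ + _.
have [u0|u0] := leP u 0; first exact: le_trans h0.
rewrite -[_ <= _]ler_sqr ?nnegrE ?(ltW u0) // exprMn e1 e2 -subr_ge0.
rewrite (_ : _ - _ = k * ((l1 * r2 - l2 * r1) ^+ 2 + (l1 * i2 - l2 * i1) ^+ 2)
  + k ^+ 2 * (r1 * i2 - i1 * r2) ^+ 2); last by rewrite /u; ring.
by rewrite addr_ge0 // mulr_ge0 ?addr_ge0 ?sqr_ge0.
Qed.

Variables s1 s2 : R.

(** If M = N N^*, the columns y, w of N may be rotated without changing M. The rotation is chosen to
    diagonalise N^* S N; then h is the gap between its eigenvalues. *)
Lemma S_orthogonal_factor m r i h :
  r ^+ 2 + i ^+ 2 <= m * (1 - m) -> 0 <= h ->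
  h ^+ 2 = (s1 * m - s2 * (1 - m)) ^+ 2 + 4 * (s1 * s2) * (r ^+ 2 + i ^+ 2) ->
  exists y1 y1' y2 y2' w1 w1' w2 w2' : R,
    [/\ y1 ^+ 2 + y1' ^+ 2 + (w1 ^+ 2 + w1' ^+ 2) = m /\
        y2 ^+ 2 + y2' ^+ 2 + (w2 ^+ 2 + w2' ^+ 2) = 1 - m,
        y1 * y2 + y1' * y2' + (w1 * w2 + w1' * w2') = r
        /\ (y1' * y2 - y1 * y2') + (w1' * w2 - w1 * w2') = i,
        s1 * (y1 ^+ 2 + y1' ^+ 2) + s2 * (y2 ^+ 2 + y2' ^+ 2)
       - (s1 * (w1 ^+ 2 + w1' ^+ 2) + s2 * (w2 ^+ 2 + w2' ^+ 2)) = h,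
     s1 * (y1 * w1 + y1' * w1') + s2 * (y2 * w2 + y2' * w2') = 0
     & s1 * (y1' * w1 - y1 * w1') + s2 * (y2' * w2 - y2 * w2') = 0].
Proof.
move=> Dm h0 hF; have [p [e [f [ef p0 er ei]]]] := polar r i.
have rip : r ^+ 2 + i ^+ 2 = p ^+ 2.
  by rewrite er ei -[RHS]mulr1 -ef; ring.
rewrite rip in Dm hF.
have m0 : 0 <= m by nra.
have m1 : 0 <= 1 - m by nra.
(* Once the phase e + f 'i is removed, M is real with off-diagonal entry p; its Cholesky factor N
   has rows (x1, 0) and (x3, x4). *)
have [x1 [x3 [x4 [x1m x34 x13]]]] : exists x1 x3 x4,
    [/\ x1 ^+ 2 = m, x3 ^+ 2 + x4 ^+ 2 = 1 - m & x1 * x3 = p].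
  have [mz|mz] := eqVneq m 0.
    have /eqP : p ^+ 2 = 0 by rewrite mz in Dm; nra.
    rewrite sqrf_eq0 => /eqP ->.
    by exists 0, 0, (Num.sqrt (1 - m)); rewrite sqr_sqrtr // mz; split; ring.
  have sm : Num.sqrt m != 0 by rewrite -sqrf_eq0 sqr_sqrtr.
  exists (Num.sqrt m), (p / Num.sqrt m), (Num.sqrt (1 - m - p ^+ 2 / m)).
  have n0 : 0 <= 1 - m - p ^+ 2 / m.
    by rewrite subr_ge0 ler_pdivrMr ?lt0r ?mz // mulrC.
  split; first exact: sqr_sqrtr.
    by rewrite expr_div_n !sqr_sqrtr //; ring.
  by field.
(* In N^* S N, [Y] is the difference of the diagonal entries and [X] twice the off-diagonal one.
   Rotating the columns by an angle turns (Y, X) by twice that angle, hence [half_angle]. *)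
set X := 2 * s2 * x3 * x4; set Y := s1 * x1 ^+ 2 + s2 * (x3 ^+ 2 - x4 ^+ 2).
have [q [u [v [uv q0 eY eX]]]] := polar Y X.
have [c [s [cs1 cs2 cs3]]] := half_angle uv.
have hq : q = h.
  apply/eqP; rewrite -(eqrXn2 (n := 2)) // hF; apply/eqP.
  transitivity (Y ^+ 2 + X ^+ 2); last by rewrite /X /Y -x34 -x1m -x13; ring.
  by rewrite eX eY -[LHS]mulr1 -uv; ring.
have diff : Y * (c ^+ 2 - s ^+ 2) - X * (2 * c * s) = h.
  by rewrite cs2 cs3 eX eY -hq -[RHS]mulr1 -uv; ring.
have orth : X * (c ^+ 2 - s ^+ 2) + Y * (2 * c * s) = 0.
  by rewrite cs2 cs3 eX eY; ring.
exists (c * x1 * e), (c * x1 * f), (c * x3 - s * x4), 0.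
exists (s * x1 * e), (s * x1 * f), (s * x3 + c * x4), 0.
have cse : (c ^+ 2 + s ^+ 2) * (e ^+ 2 + f ^+ 2) = 1 by rewrite cs1 ef mulr1.
split; [split|split|..].
- by rewrite -x1m -[RHS]mulr1 -cse; ring.
- by rewrite -x34 -[RHS]mulr1 -cs1; ring.
- by rewrite er -x13 -[RHS]mulr1 -cs1; ring.
- by rewrite ei -x13 -[RHS]mulr1 -cs1; ring.
- rewrite -diff /X /Y; transitivity
   ((s1 * x1 ^+ 2 * (e ^+ 2 + f ^+ 2) + s2 * (x3 ^+ 2 - x4 ^+ 2))
     * (c ^+ 2 - s ^+ 2) - 2 * s2 * x3 * x4 * (2 * c * s)); first by ring.
  by rewrite ef; ring.
- transitivity ((X * (c ^+ 2 - s ^+ 2) + Y * (2 * c * s)) / 2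
    + s1 * x1 ^+ 2 * c * s * (e ^+ 2 + f ^+ 2 - 1)).
    by rewrite /X /Y; field.
  by rewrite orth ef subrr; ring.
- by ring.
Qed.

End RealAlgebra.

(** * Convex hulls through real weights *)

Section Hull.
Variable R : realType.
Implicit Types (z : R[i]) (X Y : set R[i]) (t : R).

Definition mix t z1 z2 : R[i] :=
  (t * complex.Re z1 + (1 - t) * complex.Re z2)
    +i* (t * complex.Im z1 + (1 - t) * complex.Im z2).

Definition mix_closed Y : Prop :=
  forall t z1 z2, 0 <= t -> t <= 1 -> Y z1 -> Y z2 -> Y (mix t z1 z2).

Lemma convE (t : {i01 R}) (z1 z2 : convex_lmodType (Rcomplex R)) :
  conv t z1 z2 = mix t%:num z1 z2.
Proof. by case: z1 z2 => x1 y1 [x2 y2]. Qed.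

Lemma convex_setE Y : @convex_set R (Rcomplex R) Y <-> mix_closed Y.
Proof.
split=> [cY t z1 z2 t0 t1 Y1 Y2|cY z1 z2 t]; last first.
  by rewrite !inE => Y1 Y2; rewrite convE; apply: cY.
have := cY z1 z2 (Itv01 t0 t1).
by rewrite !inE convE; apply.
Qed.

Lemma conv_hull_mix X : mix_closed (conv_hull X).
Proof.
move=> t z1 z2 t0 t1 X1 X2 Y [cY XY].
by move/convex_setE: (cY) => /(_ t); apply=> //; [apply: X1|apply: X2].
Qed.

Lemma sub_conv_hull X : X `<=` conv_hull X.
Proof. exact: sub_gen_smallest. Qed.

Lemma conv_hull_sub X Y : mix_closed Y -> X `<=` Y -> conv_hull X `<=` Y.
Proof. by move=> /convex_setE; exact: smallest_sub. Qed.

End Hull.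
Arguments mix_closed {R}.

(** * Description by trace-one matrices, and convexity of the upper bild *)

Section States.
Variables (R : realType) (a b1 b2 d s1 s2 : R).
Implicit Types m r i : R.
Notation A := (hermDiag a b1 b2 d s1 s2).

(* [(m, r, i)] stands for the Hermitian matrix M with diagonal (m, 1 - m) and
   upper right entry r + i 'i; [reA] is tr(H M) and [imA] is tr(S M). *)
Definition state m r i : Prop := r ^+ 2 + i ^+ 2 <= m * (1 - m).
Definition reA m r i : R := a * m + d * (1 - m) + 2 * (b1 * r + b2 * i).
Definition imA m : R := s1 * m + s2 * (1 - m).
(** Discriminant of the characteristic polynomial of S M. This form suits Cauchy-Schwarz; [bildsqE]
    gives trace squared minus four times the determinant. *)
Definition bildsq m r i : R :=
  (s1 * m - s2 * (1 - m)) ^+ 2 + 4 * (s1 * s2) * (r ^+ 2 + i ^+ 2).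

Lemma bildsqE m r i :
  bildsq m r i = imA m ^+ 2 - 4 * (s1 * s2) * (m * (1 - m) - (r ^+ 2 + i ^+ 2)).
Proof. by rewrite /bildsq /imA; ring. Qed.

Lemma state_itv m r i : state m r i -> 0 <= m /\ 0 <= 1 - m.
Proof.
move=> Dm; have : 0 <= m * (1 - m).
  by apply: le_trans Dm; rewrite addr_ge0 ?sqr_ge0.
by split; nra.
Qed.

(** Since [imA] depends on m alone, a state can be moved to rank one along a line of constant [reA]
    without changing the point. *)
Lemma WC_stateP (z : R[i]) : WC A z <->
  exists m r i,
    [/\ state m r i, complex.Re z = reA m r i & complex.Im z = imA m].
Proof.
split=> [/WC_coordsP [p [p' [q [q' [e eR eI]]]]]|[m [r [i [Dm eR eI]]]]].
  have q2 : q ^+ 2 + q' ^+ 2 = 1 - (p ^+ 2 + p' ^+ 2) by rewrite -e; ring.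
  exists (p ^+ 2 + p' ^+ 2), (p * q + p' * q'), (p' * q - p * q').
  rewrite /state /reA /imA -q2; split=> //.
  by rewrite le_eqVlt; apply/orP; left; apply/eqP; ring.
have [r' [i' [eri eb]]] := adjust_norm b1 b2 Dm.
have [p [p' [q [q' [e1 e2 e3 e4]]]]] := rank_one_factor eri.
apply/WC_coordsP; exists p, p', q, q'.
by rewrite e1 e2 e3 e4 eb eR eI; split=> //; ring.
Qed.

Lemma upper_bild_stateP (z : R[i]) : upper_bild A z <->
  exists m r i, [/\ state m r i, complex.Re z = reA m r i,
    0 <= complex.Im z & complex.Im z ^+ 2 = bildsq m r i].
Proof.
split.
  case/upper_bild_coordsP=> z0
    [p [p' [q [q' [u [u' [v [v' [e eR eI eK eJ]]]]]]]]].
  have q2 : 1 - (p ^+ 2 + p' ^+ 2 + (u ^+ 2 + u' ^+ 2))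
          = q ^+ 2 + q' ^+ 2 + (v ^+ 2 + v' ^+ 2) by rewrite -e; ring.
  exists (p ^+ 2 + p' ^+ 2 + (u ^+ 2 + u' ^+ 2)),
    (p * q + p' * q' + (u * v + u' * v')),
    (p' * q - p * q' + (u' * v - u * v')).
  rewrite /state /reA /bildsq q2; split=> //; [|by rewrite eR; ring|].
    (* det M is the squared modulus of the determinant with columns y and w. *)
    rewrite -subr_ge0 (_ : _ - _ = (p * v - p' * v' - q * u + q' * u') ^+ 2
      + (p * v' + p' * v - q * u' - q' * u) ^+ 2); last by ring.
    by rewrite addr_ge0 ?sqr_ge0.
  rewrite eI; apply/eqP; rewrite eq_sym -subr_eq0; apply/eqP.
  (* [bildsq] exceeds (y^* S y - w^* S w)^2 by 4 |w^* S y|^2, which vanishes here. *)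
  transitivity (4 * ((s1 * (p * u + p' * u') + s2 * (q * v + q' * v')) ^+ 2
    + (s1 * (p' * u - p * u') + s2 * (q' * v - q * v')) ^+ 2)); first by ring.
  by rewrite eK eJ; ring.
case=> m [r [i [Dm eR h0 hF]]].
have [p [p' [q [q' [u [u' [v [v' [[e1 e2] [e3 e4] e5 e6 e7]]]]]]]]] :=
  S_orthogonal_factor Dm h0 hF.
apply/upper_bild_coordsP; split=> //.
exists p, p', q, q', u, u', v, v'; split=> //.
  by transitivity (m + (1 - m)); [rewrite -e2 -e1|]; ring.
by rewrite eR /reA -e2 -e1 -e3 -e4; ring.
Qed.

(** With m and [reA] fixed, raising r^2 + i^2 to m (1 - m) carries [bildsq] to [imA m ^+ 2] through
    all values between. The factor s1 s2 treats both orders at once. *)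
Lemma upper_bild_between m r i h : s1 * s2 != 0 -> state m r i -> 0 <= h ->
  0 <= s1 * s2 * (h ^+ 2 - bildsq m r i) ->
  0 <= s1 * s2 * (imA m ^+ 2 - h ^+ 2) ->
  upper_bild A (reA m r i +i* h).
Proof.
move=> s0 Dm h0; set p := s1 * s2 in s0 *; move=> hB hI.
have s10 : s1 != 0 by apply: contra s0 => /eqP e; rewrite /p e mul0r.
have s20 : s2 != 0 by apply: contra s0 => /eqP e; rewrite /p e mulr0.
have p2 : 0 < p ^+ 2 by rewrite lt0r sqrf_eq0 s0 sqr_ge0.
(* The value of r^2 + i^2 for which [bildsq] equals h^2. *)
set k := (h ^+ 2 - (s1 * m - s2 * (1 - m)) ^+ 2) / (4 * p).
have rk : r ^+ 2 + i ^+ 2 <= k.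
  rewrite -(ler_pM2l p2) -subr_ge0.
  rewrite (_ : _ - _ = (p * (h ^+ 2 - bildsq m r i)) / 4) ?divr_ge0 //.
  by rewrite /k /bildsq /p; field; rewrite s10 s20.
have [r' [i' [ek eb]]] := adjust_norm b1 b2 rk.
apply/upper_bild_stateP; exists m, r', i'; split=> //=.
- rewrite /state ek -(ler_pM2l p2) -subr_ge0.
  rewrite (_ : _ - _ = (p * (imA m ^+ 2 - h ^+ 2)) / 4) ?divr_ge0 //.
  by rewrite /k /imA /p; field; rewrite s10 s20.
- by rewrite /reA eb.
- by rewrite /bildsq ek /k /p; field; rewrite s10 s20.
Qed.

Lemma upper_bild_mix :
  s1 * s2 < 0 \/ 0 < s1 /\ 0 < s2 -> mix_closed (upper_bild A).
Proof.
move=> hs t z1 z2 t0 t1 /upper_bild_stateP [m1 [r1 [i1 [D1 eR1 h1 F1]]]].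
move=> /upper_bild_stateP [m2 [r2 [i2 [D2 eR2 h2 F2]]]].
have {}t1 : 0 <= 1 - t by rewrite subr_ge0.
have d1 : 0 <= m1 * (1 - m1) - (r1 ^+ 2 + i1 ^+ 2) by rewrite subr_ge0.
have d2 : 0 <= m2 * (1 - m2) - (r2 ^+ 2 + i2 ^+ 2) by rewrite subr_ge0.
have [m10 m11] := state_itv D1; have [m20 m21] := state_itv D2.
set m := t * m1 + (1 - t) * m2; set r := t * r1 + (1 - t) * r2.
set i := t * i1 + (1 - t) * i2.
have tt : 0 <= t * (1 - t) by rewrite mulr_ge0.
have Dm : state m r i.
  rewrite /state -subr_ge0.
  rewrite (_ : _ - _ = t * (m1 * (1 - m1) - (r1 ^+ 2 + i1 ^+ 2))
    + (1 - t) * (m2 * (1 - m2) - (r2 ^+ 2 + i2 ^+ 2))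
    + t * (1 - t) * ((m1 - m2) ^+ 2 + (r1 - r2) ^+ 2 + (i1 - i2) ^+ 2)).
    apply: addr_ge0; last by rewrite mulr_ge0 // !addr_ge0 ?sqr_ge0.
    by apply: addr_ge0; apply: mulr_ge0.
  by rewrite /m /r /i; ring.
have -> : mix t z1 z2 =
    reA m r i +i* (t * complex.Im z1 + (1 - t) * complex.Im z2).
  by rewrite /mix eR1 eR2 /reA /m /r /i; congr Complex; ring.
set h := _ + _.
have h0 : 0 <= h by rewrite addr_ge0 ?mulr_ge0.
set l1 := s1 * m1 - s2 * (1 - m1); set l2 := s1 * m2 - s2 * (1 - m2).
(* The square terms cancel, so comparing h^2 with [bildsq] reduces to Cauchy-Schwarz on the mixed
   term. *)
have cross : bildsq m r i - h ^+ 2 = 2 * (t * (1 - t)) *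
    (l1 * l2 + 4 * (s1 * s2) * (r1 * r2 + i1 * i2)
      - complex.Im z1 * complex.Im z2).
  transitivity (t ^+ 2 * (bildsq m1 r1 i1 - complex.Im z1 ^+ 2)
    + (1 - t) ^+ 2 * (bildsq m2 r2 i2 - complex.Im z2 ^+ 2)
    + 2 * (t * (1 - t)) * (l1 * l2 + 4 * (s1 * s2) * (r1 * r2 + i1 * i2)
      - complex.Im z1 * complex.Im z2)).
    by rewrite /h /bildsq /m /r /i /l1 /l2; ring.
  by rewrite F1 F2 !subrr; ring.
have imE : imA m = t * imA m1 + (1 - t) * imA m2 by rewrite /imA /m; ring.
rewrite bildsqE in F1; rewrite bildsqE in F2.
case: hs => [sn|[s1p s2p]].
  have det1 : 0 <= - (4 * (s1 * s2)) * (m1 * (1 - m1) - (r1 ^+ 2 + i1 ^+ 2)).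
    by rewrite mulr_ge0 // oppr_ge0 pmulr_rle0 // ltW.
  have det2 : 0 <= - (4 * (s1 * s2)) * (m2 * (1 - m2) - (r2 ^+ 2 + i2 ^+ 2)).
    by rewrite mulr_ge0 // oppr_ge0 pmulr_rle0 // ltW.
  (* For s1 s2 < 0 the relation reads l^2 = h^2 + k |mu|^2 with k = -4 s1 s2 > 0. So l takes the
     place of h in Cauchy-Schwarz, which requires l1 and l2 not to have opposite signs. *)
  have l12 : 0 <= l1 * l2.
    rewrite (_ : _ * _ = s1 ^+ 2 * (m1 * m2) + s2 ^+ 2 * ((1 - m1) * (1 - m2))
      + - (s1 * s2) * (m1 * (1 - m2) + m2 * (1 - m1))); last first.
      by rewrite /l1 /l2; ring.
    have sn' : 0 <= - (s1 * s2) by rewrite oppr_ge0 ltW.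
    apply: addr_ge0; last first.
      by apply: mulr_ge0 => //; apply: addr_ge0; exact: mulr_ge0.
    by apply: addr_ge0; apply: mulr_ge0; rewrite ?sqr_ge0 // mulr_ge0.
  have CS : complex.Im z1 * complex.Im z2
      + - (4 * (s1 * s2)) * (r1 * r2 + i1 * i2) <= l1 * l2.
    apply: cauchy_schwarz3 => //; first by rewrite oppr_ge0 pmulr_rle0 // ltW.
      by rewrite F1 /l1 /imA; ring.
    by rewrite F2 /l2 /imA; ring.
  apply: upper_bild_between => //; first by rewrite lt_eqF.
    rewrite nmulr_rge0 // -oppr_ge0 opprB cross.
    apply: mulr_ge0; first by rewrite mulr_ge0.
    by rewrite subr_ge0; move: CS; lra.
  rewrite nmulr_rge0 // subr_le0 -(real_normK (num_real (imA m))).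
  rewrite ler_sqr ?nnegrE ?normr_ge0 //.
  have n1 : `|imA m1| <= complex.Im z1.
    rewrite -ler_sqr ?nnegrE ?normr_ge0 // real_normK ?num_real // F1 -subr_ge0.
    by move: det1; rewrite mulNr; lra.
  have n2 : `|imA m2| <= complex.Im z2.
    rewrite -ler_sqr ?nnegrE ?normr_ge0 // real_normK ?num_real // F2 -subr_ge0.
    by move: det2; rewrite mulNr; lra.
  rewrite imE; apply: le_trans (ler_normD _ _) _.
  by rewrite !normrM (ger0_norm t0) (ger0_norm t1) lerD // ler_wpM2l.
have sp : 0 < s1 * s2 by rewrite mulr_gt0.
have k0 : 0 <= 4 * (s1 * s2) by rewrite mulr_ge0 // ltW.
have det1 : 0 <= 4 * (s1 * s2) * (m1 * (1 - m1) - (r1 ^+ 2 + i1 ^+ 2)).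
  by rewrite mulr_ge0.
have det2 : 0 <= 4 * (s1 * s2) * (m2 * (1 - m2) - (r2 ^+ 2 + i2 ^+ 2)).
  by rewrite mulr_ge0.
have CS : l1 * l2 + 4 * (s1 * s2) * (r1 * r2 + i1 * i2)
    <= complex.Im z1 * complex.Im z2.
  apply: cauchy_schwarz3 => //; first by rewrite mulr_ge0.
    by rewrite F1 /l1 /imA; ring.
  by rewrite F2 /l2 /imA; ring.
apply: upper_bild_between => //; first by rewrite gt_eqF.
  rewrite pmulr_rge0 // -oppr_le0 opprB cross.
  by rewrite mulr_ge0_le0 ?mulr_ge0 // subr_le0.
have g1 : 0 <= imA m1 by rewrite addr_ge0 // mulr_ge0 // ltW.
have g2 : 0 <= imA m2 by rewrite addr_ge0 // mulr_ge0 // ltW.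
have g0 : 0 <= imA m by rewrite imE addr_ge0 ?mulr_ge0.
rewrite pmulr_rge0 // subr_ge0 ler_sqr ?nnegrE // imE.
apply: lerD; apply: ler_wpM2l => //; rewrite -ler_sqr ?nnegrE // ?F1 ?F2.
  by move: det1; lra.
by move: det2; lra.
Qed.

End States.

(** * The three cases for a matrix in coordinates *)

Section Scaled.
Variables (R : realType) (a b1 b2 d s1 s2 : R).
Notation A := (hermDiag a b1 b2 d s1 s2).

(** Normalises a nonzero vector; passing through states avoids the square root of t. *)
Lemma WC_scaled (p p' q q' t : R) :
  p ^+ 2 + p' ^+ 2 + (q ^+ 2 + q' ^+ 2) = t -> t != 0 ->
  WC A ((a * (p ^+ 2 + p' ^+ 2) + d * (q ^+ 2 + q' ^+ 2)
       + 2 * (b1 * (p * q + p' * q') + b2 * (p' * q - p * q'))) / t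
   +i* ((s1 * (p ^+ 2 + p' ^+ 2) + s2 * (q ^+ 2 + q' ^+ 2)) / t)).
Proof.
move=> et t0; have e1 : 1 - (p ^+ 2 + p' ^+ 2) / t = (q ^+ 2 + q' ^+ 2) / t.
  by rewrite -[in LHS](divff t0) -[X in X / t - _]et; ring.
apply/WC_stateP; exists ((p ^+ 2 + p' ^+ 2) / t), ((p * q + p' * q') / t),
  ((p' * q - p * q') / t).
rewrite /state /reA /imA e1 /=; split; [|by ring..].
by rewrite le_eqVlt; apply/orP; left; apply/eqP; ring.
Qed.

End Scaled.

Section Cases.
Variables (R : realType) (a b1 b2 d s1 s2 : R).
Implicit Types m r i : R.
Notation A := (hermDiag a b1 b2 d s1 s2).
Notation A' := (hermDiag a b1 b2 d (- s1) (- s2)).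

Lemma WCplus_upper_bild : WCplus A `<=` upper_bild A.
Proof.
move=> z [/WC_coordsP [p [p' [q [q' [e eR eI]]]]] z0].
apply/upper_bild_coordsP; split=> //; exists p, p', q, q', 0, 0, 0, 0.
by rewrite eR eI; split; [rewrite -[RHS]e|..]; ring.
Qed.

(** [A'] is the adjoint of [A]. A vector w j, with y = 0, reverses the sign of the S part and keeps
    the H part. *)
Lemma WCplus_adjoint_upper_bild : WCplus A' `<=` upper_bild A.
Proof.
move=> z [/WC_coordsP [p [p' [q [q' [e eR eI]]]]] z0].
apply/upper_bild_coordsP; split=> //; exists 0, 0, 0, 0, p, p', q, q'.
by rewrite eR eI; split; [rewrite -[RHS]e|..]; ring.
Qed.

Lemma sum4sqr_eq0 (p p' q q' : R) :
  p ^+ 2 + p' ^+ 2 + (q ^+ 2 + q' ^+ 2) = 0 ->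
  [/\ p = 0, p' = 0, q = 0 & q' = 0].
Proof.
move/eqP; rewrite !paddr_eq0 ?addr_ge0 ?sqr_ge0 // !sqrf_eq0.
by move=> /andP[/andP[/eqP-> /eqP->] /andP[/eqP-> /eqP->]].
Qed.

Lemma upper_bild_indefinite : s1 * s2 < 0 ->
  upper_bild A = conv_hull (WCplus A `|` WCplus A').
Proof.
move=> sn; apply/seteqP; split; last first.
  apply: conv_hull_sub; first by apply: upper_bild_mix; left.
  by move=> z [/WCplus_upper_bild|/WCplus_adjoint_upper_bild].
move=> z /upper_bild_coordsP
  [z0 [p [p' [q [q' [u [u' [v [v' [e eR eI eK eJ]]]]]]]]]].
set Sy := s1 * (p ^+ 2 + p' ^+ 2) + s2 * (q ^+ 2 + q' ^+ 2) in eI.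
set Sw := s1 * (u ^+ 2 + u' ^+ 2) + s2 * (v ^+ 2 + v' ^+ 2) in eI.
(* With N = [y w], det (N^* S N) = det S |det N|^2, and the off-diagonal entries of N^* S N
   vanish. *)
have SyTw : Sy * Sw <= 0.
  rewrite (_ : _ * _ = (s1 * (p * u + p' * u') + s2 * (q * v + q' * v')) ^+ 2
    + (s1 * (p' * u - p * u') + s2 * (q' * v - q * v')) ^+ 2
    + s1 * s2 * ((p * v - p' * v' - q * u + q' * u') ^+ 2
      + (p * v' + p' * v - q * u' - q' * u) ^+ 2)); last first.
    by rewrite /Sy /Sw; ring.
  rewrite eK eJ expr0n !add0r nmulr_rle0 //.
  by rewrite addr_ge0 ?sqr_ge0.
have Sy0 : 0 <= Sy by rewrite eI in z0; nra.
have Sw0 : Sw <= 0 by rewrite eI in z0; nra.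
set t := p ^+ 2 + p' ^+ 2 + (q ^+ 2 + q' ^+ 2) in e.
set t' := u ^+ 2 + u' ^+ 2 + (v ^+ 2 + v' ^+ 2) in e.
have t0 : 0 <= t by rewrite !addr_ge0 ?sqr_ge0.
have t'0 : 0 <= t' by rewrite !addr_ge0 ?sqr_ge0.
(* If y or w vanishes, the point lies in one numerical range; otherwise it mixes the two normalised
   points with weights t = |y|^2 and t' = |w|^2. *)
have [tz|tn] := eqVneq t 0.
  have [ep ep' eq eq'] := sum4sqr_eq0 tz.
  apply: sub_conv_hull; right; split=> //; apply/WC_coordsP.
  exists u, u', v, v'; split; first by rewrite -[RHS]e tz add0r.
    by rewrite eR ep ep' eq eq'; ring.
  by rewrite eI /Sy /Sw ep ep' eq eq'; ring.
have [tz'|tn'] := eqVneq t' 0.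
  have [ep ep' eq eq'] := sum4sqr_eq0 tz'.
  apply: sub_conv_hull; left; split=> //; apply/WC_coordsP.
  exists p, p', q, q'; split; first by rewrite -[RHS]e tz' addr0.
    by rewrite eR ep ep' eq eq'; ring.
  by rewrite eI /Sy /Sw ep ep' eq eq'; ring.
have t'E : 1 - t = t' by rewrite -e; ring.
have y1 := @WC_scaled _ a b1 b2 d s1 s2 p p' q q' t erefl tn.
have := @WC_scaled _ a b1 b2 d (- s1) (- s2) u u' v v' t' erefl tn'.
rewrite !mulNr -opprD -/Sw; move: y1; rewrite -/Sy.
set z1 := _ +i* _; set z2 := _ +i* _ => y1 w1.
rewrite (_ : z = mix t z1 z2).
  apply: conv_hull_mix => //; first by rewrite -subr_ge0 t'E.
    by apply: sub_conv_hull; left; split;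
      [exact: y1|rewrite /upper_half_plane /= divr_ge0].
  apply: sub_conv_hull; right; split; first exact: w1.
  by rewrite /upper_half_plane /= divr_ge0 // oppr_ge0.
apply/eqP; rewrite eq_complex /= t'E eR eI /Sy /Sw.
by apply/andP; split; apply/eqP; field; rewrite tn tn'.
Qed.

Lemma upper_bild_posdef : 0 < s1 -> 0 < s2 ->
  upper_bild A = conv_hull
    (WCplus A `|` [set ((a * s2 + d * s1) / (s1 + s2))%:C]).
Proof.
move=> s1p s2p; have sp : 0 < s1 + s2 by rewrite addr_gt0.
have sn0 : s1 + s2 != 0 by rewrite gt_eqF.
have ss : 0 < s1 * s2 by rewrite mulr_gt0.
set v := (_ / _)%:C.
(* [m0] is the first diagonal entry of M0, and [c] is tr(S M0). *)
pose c := 2 * s1 * s2 / (s1 + s2); pose m0 := s2 / (s1 + s2).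
have m00 : s1 * m0 - s2 * (1 - m0) = 0 by rewrite /m0; field.
have mE m : s1 * m - s2 * (1 - m) = (s1 + s2) * (m - m0).
  by rewrite -[LHS]subr0 -m00; ring.
apply/seteqP; split; last first.
  apply: conv_hull_sub; first by apply: upper_bild_mix; right.
  move=> z [/WCplus_upper_bild //|->].
  apply/upper_bild_stateP; exists m0, 0, 0; split => //=.
  - rewrite /state expr0n addr0 /m0.
    have -> : 1 - s2 / (s1 + s2) = s1 / (s1 + s2) by field.
    by rewrite mulr_ge0 // divr_ge0 // ltW.
  - by rewrite /reA /m0; field.
  - by rewrite /bildsq m00; ring.
move=> z /upper_bild_stateP [m [r [i [Dm eR h0 F]]]].
set h := complex.Im z in h0 F.
have [hz|hn] := eqVneq h 0.
  have : (s1 + s2) ^+ 2 * (m - m0) ^+ 2 + 4 * (s1 * s2) * (r ^+ 2 + i ^+ 2) = 0.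
    by rewrite -exprMn -mE -/(bildsq s1 s2 m r i) -F hz expr0n.
  move/eqP; rewrite paddr_eq0; last 2 first.
  - by rewrite mulr_ge0 ?sqr_ge0.
  - by rewrite !mulr_ge0 ?addr_ge0 ?sqr_ge0 // ltW.
  rewrite !mulf_eq0 !orbb (negbTE sn0) (gt_eqF s1p) (gt_eqF s2p) pnatr_eq0 /=.
  rewrite subr_eq0 paddr_eq0 ?sqr_ge0 // !sqrf_eq0.
  move=> /andP[/eqP em /andP[/eqP er /eqP ei]].
  apply: sub_conv_hull; right; apply/eqP.
  rewrite eq_complex -/h hz /= eqxx andbT eR.
  by apply/eqP; rewrite em er ei /reA /m0; field.
have hp : 0 < h by rewrite lt0r hn.
have det0 : 0 <= m * (1 - m) - (r ^+ 2 + i ^+ 2) by rewrite subr_ge0.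
have im0 : 0 <= imA s1 s2 m.
  by have [? ?] := state_itv Dm; rewrite addr_ge0 // mulr_ge0 // ltW.
have h1 : h <= imA s1 s2 m.
  rewrite -ler_sqr ?nnegrE // F bildsqE -subr_ge0 opprB addrC subrK.
  by rewrite !mulr_ge0 // ltW.
have imE n : imA s1 s2 n = c + (s1 - s2) * (n - m0).
  by rewrite /imA /c /m0; field.
have h2 : imA s1 s2 m - c < h.
  rewrite imE.
  have : ((s1 - s2) * (m - m0)) ^+ 2 < h ^+ 2.
    have [mm|mm] := eqVneq m m0.
      by rewrite mm subrr mulr0 expr0n exprn_gt0.
    apply: (@lt_le_trans _ _ (((s1 + s2) * (m - m0)) ^+ 2)).
      rewrite !exprMn ltr_pM2r;
        last by rewrite lt0r sqrf_eq0 subr_eq0 mm sqr_ge0.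
      by rewrite -subr_gt0 (_ : _ - _ = 4 * (s1 * s2)) ?mulr_gt0 //; ring.
    rewrite F /bildsq -mE lerDl.
    by rewrite !mulr_ge0 ?addr_ge0 ?sqr_ge0 // ltW.
  by move=> lt; nra.
have cp : 0 < c by rewrite divr_gt0 // !mulr_gt0.
(* On the ray from M0 through M, let M' = M0 + (M - M0) / t. There the bild height is h / t and the
   trace is c + (s1 - s2)(m - m0) / t; equating them gives t. The bound [h2] makes t positive. *)
set t := 1 - (imA s1 s2 m - h) / c.
have t0 : 0 < t by rewrite subr_gt0 ltr_pdivrMr // mul1r; lra.
have t1 : t <= 1 by rewrite gerBl divr_ge0 ?subr_ge0 // ltW.
pose m' := m0 + (m - m0) / t.
have tn0 : t != 0 by rewrite gt_eqF.
have tc : t * c = c - imA s1 s2 m + h by rewrite /t; field; rewrite gt_eqF.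
have im' : imA s1 s2 m' = h / t.
  apply: (mulIf tn0); rewrite divfK // imE /m'.
  transitivity (t * c + (s1 - s2) * (m - m0)); first by field.
  by rewrite tc imE; ring.
have bild' : bildsq s1 s2 m' (r / t) (i / t) = (h / t) ^+ 2.
  by rewrite expr_div_n F /bildsq !mE /m'; field.
have wc : WC A (reA a b1 b2 d m' (r / t) (i / t) +i* (h / t)).
  apply/WC_stateP; exists m', (r / t), (i / t); split=> //.
  (* Equality of [bildsq] and [imA ^+ 2] forces det M' = 0, so M' is a state of rank one. *)
  move: bild'; rewrite bildsqE im' => /eqP.
  rewrite -subr_eq0 addrAC subrr add0r oppr_eq0 !mulf_eq0.
  rewrite (gt_eqF s1p) (gt_eqF s2p) pnatr_eq0 /= subr_eq0 => /eqP e.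
  by rewrite /state -e.
rewrite (_ : z = mix t (reA a b1 b2 d m' (r / t) (i / t) +i* (h / t)) v).
  apply: conv_hull_mix => //; first exact: ltW.
    by apply: sub_conv_hull; left; split=> //;
      rewrite /upper_half_plane /= divr_ge0 // ltW.
  by apply: sub_conv_hull; right.
apply/eqP; rewrite eq_complex /= eR -/h; apply/andP; split; apply/eqP.
  by rewrite /reA /m' /m0; field; rewrite ?tn0 ?sn0.
by field.
Qed.

(** With det S = 0, [bildsq] is the square of [imA], which is nonnegative. *)
Lemma upper_bild_semidef : 0 <= s1 -> 0 <= s2 -> s1 * s2 = 0 ->
  upper_bild A = WCplus A.
Proof.
move=> s10 s20 s0; apply/seteqP; split; last exact: WCplus_upper_bild.
move=> z /upper_bild_stateP [m [r [i [Dm eR h0 F]]]]; split=> //.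
apply/WC_stateP; exists m, r, i; split=> //.
have [m1 m2] := state_itv Dm.
apply/eqP; rewrite -(eqrXn2 (n := 2)) //; last by rewrite addr_ge0 // mulr_ge0.
by rewrite F bildsqE s0; apply/eqP; ring.
Qed.

End Cases.

(** * From matrix hypotheses to coordinates, and the final statement *)

Section Entries.
Variable R : realType.
Implicit Types (H : 'M[R[i]]_2) (S : 'M[R]_2).

Lemma ord2E (i : 'I_2) : (i == ord0) || (i == ord_max).
Proof. by case: i => [[|[]]]. Qed.

Lemma hermDiagE H S : H \is hermsymmx -> is_diag_mx S ->
  exists a b1 b2 d, H + (0 +i* 1) *: map_mx (real_complex R) S
    = hermDiag a b1 b2 d (S ord0 ord0) (S ord_max ord_max).
Proof.
move=> /is_hermitianmxP; rewrite expr0 scale1r => /matrixP hH /is_diag_mxP dS.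
have S01 : S ord0 ord_max = 0 by apply: dS.
have S10 : S ord_max ord0 = 0 by apply: dS.
have := hH ord_max ord0; have := hH ord0 ord0; have := hH ord_max ord_max.
rewrite !mxE /= !conjCE.
case e0 : (H ord0 ord0) => [a a']; case e1 : (H ord_max ord_max) => [d d'].
case e2 : (H ord0 ord_max) => [b1 b2] /= [d0] [a0] e3.
have {}d0 : d' = 0 by lra.
have {}a0 : a' = 0 by lra.
exists a, b1, b2, d; apply/matrixP => i j; rewrite !mxE.
case/orP: (ord2E i) => /eqP ->; case/orP: (ord2E j) => /eqP -> /=;
  rewrite ?e0 ?e1 ?e2 ?e3 ?S01 ?S10 ?a0 ?d0; apply/eqP; rewrite eq_complex /=;
  by apply/andP; split; apply/eqP; ring.
Qed.

Lemma hermDiag_adjoint (a b1 b2 d s1 s2 : R) :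
  (hermDiag a b1 b2 d s1 s2) ^t Num.conj = hermDiag a b1 b2 d (- s1) (- s2).
Proof.
apply/matrixP => i j; rewrite !mxE conjCE.
by case/orP: (ord2E i) => /eqP ->; case/orP: (ord2E j) => /eqP -> //=;
  rewrite opprK.
Qed.

Lemma real_unitE (x : 'cV[R]_2) :
  real_unit x <-> x ord0 0 ^+ 2 + x ord_max 0 ^+ 2 = 1.
Proof.
have -> : ord_max = lift ord0 ord0 :> 'I_2 by apply/val_inj.
split=> [/matrixP/(_ 0 0)|e].
  by rewrite !mxE !big_ord_recl !big_ord0 !addr0 !mxE.
apply/matrixP => i j; rewrite !ord1.
by rewrite !mxE !big_ord_recl !big_ord0 !addr0 !mxE.
Qed.

Lemma real_qform_diag S (x : 'cV[R]_2) : is_diag_mx S ->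
  real_qform S x =
    S ord0 ord0 * x ord0 0 ^+ 2 + S ord_max ord_max * x ord_max 0 ^+ 2.
Proof.
move=> /is_diag_mxP dS.
have S01 : S ord0 ord_max = 0 by apply: dS.
have S10 : S ord_max ord0 = 0 by apply: dS.
move: S01 S10; have -> : ord_max = lift ord0 ord0 :> 'I_2 by apply/val_inj.
move=> S01 S10; rewrite /real_qform.
by rewrite !mxE !big_ord_recl !big_ord0 !addr0 !mxE !big_ord_recl !big_ord0
   !addr0 !mxE S01 S10; ring.
Qed.

Lemma real_qform_basis S : is_diag_mx S ->
  exists x y, [/\ real_unit x, real_unit y, real_qform S x = S ord0 ord0
                & real_qform S y = S ord_max ord_max].
Proof.
move=> dS; exists (delta_mx ord0 0), (delta_mx ord_max 0).
by split; first [apply/real_unitE | rewrite real_qform_diag //];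
  rewrite !mxE /=; ring.
Qed.

Lemma posdef_diagP S : is_diag_mx S ->
  posdef S <-> 0 < S ord0 ord0 /\ 0 < S ord_max ord_max.
Proof.
move=> dS; split=> [pS|[p0 p1] x /real_unitE ex]; last first.
  rewrite real_qform_diag //.
  have := sqr_ge0 (x ord0 0); have := sqr_ge0 (x ord_max 0).
  (* One of the two squares is at least 1/2, which makes the form strictly positive. *)
  by have [?|?] := lerP (x ord0 0 ^+ 2) (1 / 2); nra.
by have [x [y [/pS + /pS + <- <-]]] := real_qform_basis dS.
Qed.

Lemma possemidef_diag S : is_diag_mx S -> possemidef S ->
  0 <= S ord0 ord0 /\ 0 <= S ord_max ord_max.
Proof.
by move=> dS pS; have [x [y [/pS + /pS + <- <-]]] := real_qform_basis dS.
Qed.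

(** If the product of the entries were nonnegative, so would be the product of any two values of the
    form. *)
Lemma indefinite_diag S : is_diag_mx S -> indefinite S ->
  S ord0 ord0 * S ord_max ord_max < 0.
Proof.
move=> dS [x [y [_ _]]]; rewrite !real_qform_diag // => qx qy.
rewrite ltNge; apply/negP => s0; move: qx; rewrite -(nmulr_llt0 _ qy) ltNge.
move=> /negP; apply.
set s1 := S _ _ in s0 *; set s2 := S _ _ in s0 *.
have sqM (u v : R) : 0 <= u ^+ 2 * v ^+ 2 by rewrite mulr_ge0 ?sqr_ge0.
rewrite [leRHS](_ : _ = s1 ^+ 2 * (x ord0 0 * y ord0 0) ^+ 2
  + s2 ^+ 2 * (x ord_max 0 * y ord_max 0) ^+ 2
  + s1 * s2 * (x ord0 0 ^+ 2 * y ord_max 0 ^+ 2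
    + x ord_max 0 ^+ 2 * y ord0 0 ^+ 2)); last by ring.
apply: addr_ge0; last by apply: mulr_ge0 => //; exact: addr_ge0.
by apply: addr_ge0; apply: mulr_ge0; exact: sqr_ge0.
Qed.

End Entries.

Theorem corollary3p11 (R : realType) (A H : 'M[R[i]]_2) (S : 'M[R]_2)
    (hH : H \is hermsymmx) (hS : is_diag_mx S)
    (hA : A = H + (0 +i* 1) *: map_mx (real_complex R) S) :
  [/\ indefinite S ->
        upper_bild A = conv_hull (WCplus A `|` WCplus (A ^t Num.conj)),
      posdef S ->
        exists v : R, upper_bild A = conv_hull (WCplus A `|` [set v%:C])
    & possemidef S -> ~ posdef S ->
        upper_bild A = WCplus A].
Proof.
have [a [b1 [b2 [d AE]]]] := hermDiagE hH hS; rewrite -hA in AE.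
split=> [/(indefinite_diag hS) s_lt0|/(posdef_diagP hS) [s1 s2]|
         /(possemidef_diag hS) [s1 s2] npos].
- by rewrite AE hermDiag_adjoint; exact: upper_bild_indefinite.
- by eexists; rewrite AE; exact: upper_bild_posdef.
rewrite AE; apply: upper_bild_semidef => //.
(* Semi-definite but not definite means that a diagonal entry is zero, so det S = 0. *)
apply/eqP; apply: contra_notT npos => /= s0; apply/(posdef_diagP hS).
by move: s0; rewrite mulf_eq0 !lt0r s1 s2 !andbT => /norP[].
Qed.
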